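(* There exists a Hausdorff, metrizable, locally $m$-convex complex continuous inverse algebra $B$ whose Hausdorff completion $\widehat B$ has the following properties: (1) $\widehat B$ is a Fréchet locally $m$-convex algebra; (2) the inversion map $\widehat B^{\times}\to\widehat B$, $a\mapsto a^{-1}$, is continuous (with $\widehat B^{\times}$ carrying the subspace topology); (3) the unit group $\widehat B^{\times}$ is not open in $\widehat B$. Consequently, $\widehat B$ is not a continuous inverse algebra.
   Context: All algebras are associative and over $\mathbb C$. A locally convex algebra is an algebra with a locally convex vector space topology for which multiplication is (jointly) continuous. A unital locally convex algebra $A$ is a continuous inverse algebra (CIA) if its unit group $A^{\times}$ (the set of invertible elements) is open in $A$ and the inversion map $A^{\times}\to A$, $a\mapsto a^{-1}$, is continuous. A locally convex algebra is locally $m$-convex if its topology is generated by a family of submultiplicative seminorms ($p(ab)\le p(a)p(b)$). A Fréchet algebra is a locally convex algebra whose underlying space is complete, Hausdorff and metrizable. The Hausdorff completion $\widehat B$ is the completion of the locally convex space $B$, with the unique continuous extension of the multiplication of $B$. *)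

(* Defs.v *)
From HB Require Import structures.
From mathcomp Require Import all_boot all_order all_algebra.
From mathcomp Require Export complex.
From mathcomp Require Export all_classical all_reals all_analysis.
Export numFieldTopology.Exports numFieldNormedType.Exports.
Import Order.TTheory GRing.Theory Num.Theory.

Set Implicit Arguments.
Unset Strict Implicit.
Unset Printing Implicit Defensive.

Local Open Scope classical_set_scope.
Local Open Scope ring_scope.

(* A tvsType is by definition locally convex. The algebras are unital and, as
   for every algType, nonzero. The UnitRing component is no restriction: its
   axioms force GRing.unit to be the set of all two-sided invertible elements
   and ^-1 to be the inversion there. *)
HB.mixin Record UnitAlgebraTvs_isLocConvAlgebra (K : numFieldType) A
    & GRing.UnitAlgebra K A & Tvs K A := {
  mul_continuous : continuous (fun z : A * A => z.1 * z.2)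
}.

#[short(type="locConvAlgType")]
HB.structure Definition LocConvAlgebra (K : numFieldType) :=
  {A of GRing.UnitAlgebra K A & Tvs K A & UnitAlgebraTvs_isLocConvAlgebra K A}.

Section TopologicalNotions.
Variable R : realType.

Definition metrizable (T : topologicalType) : Prop :=
  exists d : T -> T -> R,
    [/\ forall x y, d x y = 0 <-> x = y,
        forall x y, d x y = d y x,
        forall x y z, d x z <= d x y + d y z
      & forall (x : T) (U : set T),
          nbhs x U <-> exists2 e : R, 0 < e & [set y | d x y < e] `<=` U].

(* Completeness is stated for the additive uniform structure determined by the
   neighbourhoods of 0: the axioms of tvsType do not require its `entourage` to
   be translation-invariant, so the library's `cauchy` cannot be used here. *)
Definition tvs_cauchy (E : tvsType R[i]) (F : set_system E) : Prop :=
  forall U : set E, nbhs 0 U ->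
    exists2 A, F A & forall x y, A x -> A y -> U (x - y).

Definition tvs_complete (E : tvsType R[i]) : Prop :=
  forall F : set_system E, ProperFilter F -> tvs_cauchy F ->
    exists l : E, F --> l.

End TopologicalNotions.

Section LocallyConvexAlgebras.
Variable R : realType.
Implicit Types A B C : locConvAlgType R[i].

(* `Re `|c|` is the modulus of c as an element of R; the norm of R[i] takes its
   values in R[i]. *)
Definition is_seminorm A (p : A -> R) : Prop :=
  (forall x y, p (x + y) <= p x + p y) /\
  (forall (c : R[i]) x, p (c *: x) = complex.Re `|c| * p x).

Definition submultiplicative A (p : A -> R) : Prop :=
  forall x y, p (x * y) <= p x * p y.

Definition generates_topology A (P : set (A -> R)) : Prop :=
  forall (x : A) (U : set A), nbhs x U <->
    exists F : set (A -> R), exists e : R,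
      [/\ finite_set F, F `<=` P, 0 < e
        & [set y | forall p, F p -> p (y - x) < e] `<=` U].

Definition locally_m_convex A : Prop :=
  exists P : set (A -> R),
    (forall p, P p -> is_seminorm p /\ submultiplicative p) /\
    generates_topology P.

Definition units A : set A := [set a | a \is a GRing.unit].
Arguments units A : clear implicits.

Definition inversion_continuous A : Prop :=
  {within units A, continuous (@GRing.inv A)}.

Definition continuous_inverse_algebra A : Prop :=
  open (units A) /\ inversion_continuous A.

Definition frechet A : Prop :=
  [/\ tvs_complete A, hausdorff_space A & metrizable R A].

(* (C, i) is a Hausdorff completion of B. As C is a topological algebra and i an
   algebra morphism, the product of C is the continuous extension of that of B.
   The third clause says that B carries the initial topology along i. *)
Definition is_hausdorff_completion B C (i : {lrmorphism B -> C}) : Prop :=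
  [/\ tvs_complete C,
      hausdorff_space C,
      forall (x : B) (U : set B),
        nbhs x U <-> exists2 V : set C, nbhs (i x) V & i @^-1` V `<=` U
    & dense (range i)].

End LocallyConvexAlgebras.

Arguments units {R} A _.

(* Main.v *)
Require Import Defs.
From HB Require Import structures.
From mathcomp Require Import all_boot all_order all_algebra.
From mathcomp Require Import complex all_classical all_reals all_analysis.
From mathcomp Require Import zify lra ring.
Import Order.TTheory GRing.Theory Num.Theory.
Import Normc.

Set Implicit Arguments.
Unset Strict Implicit.
Unset Printing Implicit Defensive.

Local Open Scope classical_set_scope.
Local Open Scope ring_scope.

(* For infinite upper triangular matrices f put
   p_n f = sup_i sum_l |f_(i, i+l)| (n+1)^l, a submultiplicative seminorm. Let B
   consist of the matrices with constant diagonal and all p_n finite that are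
   block diagonal with blocks of size 2^k for some k. Such a matrix is a scalar
   plus a nilpotent one, so its invertibility is decided by its diagonal and the
   units of B are open. The completion of B consists of the limits of
   block-diagonal matrices. It contains the weighted shift x with
   x_(i, i+1) = e 2^-v(i+1), v the 2-adic valuation, because discarding the
   entries that cross a block boundary changes x by at most e 2^-k. The entry
   (0, l) of an inverse of 1 - x is e^l 2^-v(l!) >= (e/2)^l, so its p_N is
   infinite for large N: 1 - x is not invertible, although p_n x <= e (n+1) is
   as small as we please. *)

(** * Topology defined by an increasing sequence of submultiplicative seminorms *)

Lemma Re_normr (R : realType) (c : R[i]) : complex.Re `|c| = normc c.
Proof. by case: c. Qed.

Lemma normc_ge0 (R : realType) (c : R[i]) : 0 <= normc c.
Proof. by case: c => a b; rewrite /normc sqrtr_ge0. Qed.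

Lemma normcB (R : realType) (c d : R[i]) : normc (c - d) = normc (d - c).
Proof. by rewrite -normcN opprB. Qed.

Section SeminormSystem.
Variable R : realType.

Record seminorm_system (A : unitAlgType R[i]) (p : nat -> A -> R) : Prop := {
  sn_leS : forall n x, p n x <= p n.+1 x;
  snD : forall n x y, p n (x + y) <= p n x + p n y;
  snZ : forall n (c : R[i]) x, p n (c *: x) = normc c * p n x;
  snM : forall n x y, p n (x * y) <= p n x * p n y }.

Section Theory.
Variables (A : unitAlgType R[i]) (p : nat -> A -> R).
Hypothesis hp : seminorm_system p.

Lemma sn0 n : p n 0 = 0.
Proof. by rewrite -(scale0r 0) (snZ hp) normc0 mul0r. Qed.

Lemma snN n x : p n (- x) = p n x.
Proof. by rewrite -scaleN1r (snZ hp) normcN normc1 mul1r. Qed.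

Lemma snB n x y : p n (x - y) = p n (y - x).
Proof. by rewrite -snN opprB. Qed.

Lemma sn_ge0 n x : 0 <= p n x.
Proof.
by have := snD hp n x (- x); rewrite subrr sn0 snN -mulr2n pmulrn_lge0.
Qed.

Lemma sn_mono m n x : (m <= n)%N -> p m x <= p n x.
Proof.
move=> /subnK <-; elim: (n - m)%N => //= k IH.
by rewrite addSn (le_trans IH)// (sn_leS hp).
Qed.

Lemma sn_triangle n x y z : p n (x - z) <= p n (x - y) + p n (y - z).
Proof. by rewrite (le_trans _ (snD hp _ _ _))// addrA subrK. Qed.

(** One index [n] suffices, since the seminorms increase: a finite intersection of such sets
    contains another one, with the largest index and the smallest radius. *)
Definition sn_entourage (E : set (A * A)) : Prop :=
  exists n, exists2 e : R, 0 < e & [set z | p n (z.1 - z.2) < e] `<=` E.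

Lemma sn_entourage_filter : Filter sn_entourage.
Proof.
split; first by exists 0%N, 1.
- move=> P Q [n [e e0 eP]] [m [d d0 dQ]].
  exists (maxn n m), (Num.min e d); first by rewrite lt_min e0.
  move=> z /= zp; split.
    apply: eP; rewrite /= (le_lt_trans (sn_mono _ (leq_maxl n m)))//.
    by rewrite (lt_le_trans zp)// ge_min lexx.
  apply: dQ; rewrite /= (le_lt_trans (sn_mono _ (leq_maxr n m)))//.
  by rewrite (lt_le_trans zp)// ge_min lexx orbT.
- by move=> P Q PQ [n [e e0 eP]]; exists n, e => // z /eP /PQ.
Qed.

Lemma sn_entourage_diagonal E : sn_entourage E -> diagonal `<=` E.
Proof.
by move=> [n [e e0 eE]] z zd; apply: eE; rewrite /= (zd : z.1 = z.2) subrr sn0.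
Qed.

Lemma sn_entourage_inv E : sn_entourage E -> sn_entourage (E^-1)%relation.
Proof.
by move=> [n [e e0 eE]]; exists n, e => // -[x y] /= xy; apply: eE; rewrite /= snB.
Qed.

Lemma sn_entourage_split E : sn_entourage E ->
  exists2 B, sn_entourage B & (B \; B)%relation `<=` E.
Proof.
move=> [n [e e0 eE]]; exists [set z | p n (z.1 - z.2) < e / 2].
  by exists n, (e / 2) => //; rewrite divr_gt0.
move=> [x z] [y /= xy yz]; apply: eE => /=.
by rewrite (le_lt_trans (sn_triangle _ _ y _))// [ltRHS]splitr ltrD.
Qed.

Lemma nbhs_sn_entourage (x : A) (U : set A) : nbhs_ sn_entourage x U <->
  exists n, exists2 e : R, 0 < e & [set y | p n (x - y) < e] `<=` U.
Proof.
split.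
  move=> [E [n [e e0 eE]] EU]; exists n, e => // y xy.
  by apply: EU; apply/mem_set; apply: eE.
move=> [n [e e0 eU]]; exists [set z | p n (z.1 - z.2) < e].
  by exists n, e.
by move=> y /set_mem; apply: eU.
Qed.

(** Splits [x * y - a * b] as [(x - a) * y + a * (y - b)]. Capping [d] by 1 bounds [p n a] by
    [p n x + 1], so that [K] controls both terms. *)
Lemma sn_mul_near n x y e : 0 < e -> exists2 d, 0 < d &
  forall a b, p n (x - a) < d -> p n (y - b) < d -> p n (x * y - a * b) < e.
Proof.
move=> e0; pose K := p n x + p n y + 1.
have x0 := sn_ge0 n x; have y0 := sn_ge0 n y.
have K0 : 0 < K by rewrite /K; lra.
have d0 : 0 < Num.min 1 (e / K / 2) by rewrite lt_min ltr01 !divr_gt0.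
exists (Num.min 1 (e / K / 2)) => // a b xa yb.
set d := Num.min 1 (e / K / 2) in d0 xa yb *.
have d1 : d <= 1 by rewrite ge_min lexx.
have de : d * K < e.
  rewrite (@le_lt_trans _ _ (e / 2)) ?ltr_pdivrMr ?ltr_pMr ?ltr1n//.
  by rewrite -ler_pdivlMr// mulrAC ge_min lexx orbT.
have -> : x * y - a * b = (x - a) * y + a * (y - b).
  by rewrite mulrBl mulrBr addrA subrK.
rewrite (le_lt_trans (snD hp _ _ _))//.
have h1 := snM hp n (x - a) y; have h2 := snM hp n a (y - b).
have h3 : p n a <= p n x + p n (x - a).
  by rewrite -{1}(subKr x a) (le_trans (snD hp _ _ _))// snN.
have h5 : p n a * p n (y - b) <= (p n x + 1) * d.
  by rewrite ler_pM ?sn_ge0// ?ltW// (le_lt_trans h3)// ltrD2l (lt_le_trans xa).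
have h6 : p n (x - a) * p n y <= d * p n y by rewrite ler_wpM2r// ltW.
by rewrite (le_lt_trans _ de)// /K; lra.
Qed.

(** A scalar acts as multiplication by its multiple of the unit, so the estimate for products
    applies. As [p n 1] may be any nonnegative real, zero included, the division is by
    [p n 1 + 1]. *)
Lemma sn_scale_near n (c : R[i]) x e : 0 < e -> exists2 d, 0 < d &
  forall b y, normc (c - b) < d -> p n (x - y) < d -> p n (c *: x - b *: y) < e.
Proof.
move=> e0; have /(_ c%:A x)[d d0 H] := @sn_mul_near n _ _ _ e0.
have n1 := sn_ge0 n 1.
exists (Num.min d (d / (p n 1 + 1))); first by rewrite lt_min d0 divr_gt0// ltr_wpDl.
move=> b y cb xy; have := H b%:A y; rewrite !mulr_algl; apply.
  rewrite -scalerBl (snZ hp).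
  rewrite (@le_lt_trans _ _ (normc (c - b) * (p n 1 + 1)))//.
    by rewrite ler_wpM2l ?normc_ge0// lerDl.
  by rewrite -ltr_pdivlMr ?ltr_wpDl// (lt_le_trans cb)// ge_min lexx orbT.
by rewrite (lt_le_trans xy)// ge_min lexx.
Qed.

(* [p (y^-1) <= p (x^-1) + p (x^-1) * p (x - y) * p (y^-1)] bounds [p (y^-1)]
   for [y] near [x]. *)
Lemma sn_inv_near n x e : 0 < e -> x \is a GRing.unit -> exists2 d, 0 < d &
  forall y, y \is a GRing.unit -> p n (x - y) < d -> p n (x^-1 - y^-1) < e.
Proof.
move=> e0 ux; pose K := p n x^-1 + 1.
have x0 := sn_ge0 n x^-1.
have K0 : 0 < K by rewrite /K; lra.
have d0 : 0 < Num.min (2^-1 / K) (e / (2 * K * K)).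
  by rewrite lt_min !divr_gt0// ?mulr_gt0.
exists (Num.min (2^-1 / K) (e / (2 * K * K))) => // y uy.
rewrite lt_min => /andP[]; rewrite !ltr_pdivlMr ?mulr_gt0// => xy1 xy2.
have E : x^-1 - y^-1 = x^-1 * (y - x) * y^-1.
  by rewrite mulrBr mulrBl mulrK// mulVr// mul1r.
have xy0 := sn_ge0 n (x - y); have y0 := sn_ge0 n y^-1.
have le1 : p n (x^-1 - y^-1) <= p n x^-1 * p n (x - y) * p n y^-1.
  rewrite E (le_trans (snM hp _ _ _))// ler_wpM2r//.
  by rewrite (le_trans (snM hp _ _ _))// (snB n y).
have le2 : p n y^-1 <= p n x^-1 + p n (x^-1 - y^-1).
  by rewrite -{1}(subKr x^-1 y^-1) (le_trans (snD hp _ _ _))// snN.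
have le3 : p n x^-1 * p n (x - y) <= 2^-1.
  by apply/ltW/(le_lt_trans _ xy1); rewrite mulrC ler_wpM2l// /K; lra.
have le4 : p n y^-1 <= 2 * K by rewrite /K; nra.
apply: (le_lt_trans le1); apply: (le_lt_trans _ xy2).
rewrite mulrAC mulrC ler_wpM2l// [leRHS]mulrAC [leRHS]mulrC ler_pM// /K; lra.
Qed.

End Theory.
End SeminormSystem.

(** * Locally convex algebras built from a system of seminorms *)

HB.factory Record UnitAlgebra_isSeminormed (R : realType) A
    & GRing.UnitAlgebra R[i] A := {
  seminorms : nat -> A -> R;
  seminormsP : seminorm_system seminorms }.

HB.builders Context R A & UnitAlgebra_isSeminormed R A.

HB.instance Definition _ := isUniform.Build A
  (sn_entourage_filter seminormsP) (sn_entourage_diagonal seminormsP)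
  (sn_entourage_inv seminormsP) (sn_entourage_split seminormsP).

Lemma nbhs_sn (x : A) (U : set A) : nbhs x U <->
  exists n, exists2 e : R, 0 < e & [set y | seminorms n (x - y) < e] `<=` U.
Proof. exact: (nbhs_sn_entourage seminorms). Qed.

Lemma sn_add_continuous : continuous (fun z : A * A => z.1 + z.2).
Proof.
move=> [x y] U /nbhs_sn [n [e e0 eU]].
exists ([set a | seminorms n (x - a) < e / 2], [set b | seminorms n (y - b) < e / 2]).
  by split; apply/nbhs_sn; exists n, (e / 2) => //; rewrite divr_gt0.
move=> [a b] [/= xa yb]; apply: eU; rewrite /= opprD addrACA.
by rewrite (le_lt_trans (snD seminormsP _ _ _))// [ltRHS]splitr ltrD.
Qed.

Lemma nbhs_normc (c : R[i]^o) (d : R) : 0 < d -> nbhs c [set b | normc (c - b) < d].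
Proof.
move=> d0; apply/nbhs_ballP; exists d%:C%C => /=; first by rewrite ltcR.
by move=> b; rewrite -ball_normE /=; case: (c - b) => u v /=; rewrite ltcR.
Qed.

Lemma sn_scale_continuous : continuous (fun z : R[i]^o * A => z.1 *: z.2).
Proof.
move=> [c x] U /nbhs_sn [n [e e0 eU]].
have [d d0 H] := sn_scale_near seminormsP n c x e0.
exists ([set b : R[i] | normc (c - b) < d], [set y | seminorms n (x - y) < d]).
  by split; [exact: nbhs_normc|apply/nbhs_sn; exists n, d].
by move=> [b y] [/= cb xy]; apply: eU; apply: H.
Qed.

Lemma sn_mul_continuous : continuous (fun z : A * A => z.1 * z.2).
Proof.
move=> [x y] U /nbhs_sn [n [e e0 eU]].
have [d d0 H] := sn_mul_near seminormsP n x y e0.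
exists ([set a | seminorms n (x - a) < d], [set b | seminorms n (y - b) < d]).
  by split; apply/nbhs_sn; exists n, d.
by move=> [a b] [/= xa yb]; apply: eU; apply: H.
Qed.

Lemma sn_ball_open n x e : open [set y | seminorms n (x - y) < e].
Proof.
rewrite openE => y /= xy; apply/nbhs_sn.
exists n, (e - seminorms n (x - y)); first by rewrite subr_gt0.
move=> z /= yz; rewrite (le_lt_trans (sn_triangle seminormsP _ _ y _))//.
by rewrite -ltrBrDl.
Qed.

Local Open Scope convex_scope.

Lemma sn_locally_convex : exists2 B : set_system A,
  (forall b, b \in B -> convex_set b) & basis B.
Proof.
exists [set b | exists x n e, b = [set y | seminorms n (x - y) < e]].
  move=> b /set_mem[x [n [e ->]]].
  apply/convex_setW => y z /set_mem /= xy /set_mem /= xz l l0 l1.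
  apply/mem_set => /=.
  have -> : x - (y : convex_lmodType A) <| l |> z =
      (l%:num : R[i]) *: (x - y) + (1 - l%:num : R[i]) *: (x - z).
    rewrite !scalerBr addrACA -opprD -[_ *: x + _]scalerDl.
    by rewrite [l%:num + _]addrC subrK scale1r.
  (* The weights of a convex combination are nonnegative elements of [R[i]]. Their moduli are the
     corresponding reals [s] and [t], with sum 1; strictness of the final inequality comes from
     [0 < s]. *)
  have normc_ger0 (a : R[i]) : 0 <= a -> (normc a)%:C%C = a.
    by move=> a0; rewrite -[RHS](ger0_norm a0); case: a {a0}.
  rewrite (le_lt_trans (snD seminormsP _ _ _))// !(snZ seminormsP).
  have : normc (l%:num : R[i]) + normc (1 - l%:num : R[i]) = 1.
    apply/(@complexI R); rewrite rmorphD /= !normc_ger0 ?subr_ge0//.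
    by rewrite addrC subrK.
  have : 0 < normc (l%:num : R[i]) by rewrite -ltcR normc_ger0// ltW.
  have := normc_ge0 (1 - l%:num : R[i]).
  set t := normc (1 - _); set s := normc _ => t0 s0 st.
  have s1 : s * seminorms n (x - y) < s * e by rewrite ltr_pM2l.
  have t1 : t * seminorms n (x - z) <= t * e by rewrite ler_wpM2l// ltW.
  by rewrite -[ltRHS]mul1r -st mulrDl ltr_leD.
split; first by move=> b [x [n [e ->]]]; exact: sn_ball_open.
move=> x U /nbhs_sn [n [e e0 eU]].
exists [set y | seminorms n (x - y) < e] => //.
by split; [exists x, n, e|rewrite /= subrr (sn0 seminormsP)].
Qed.

HB.instance Definition _ :=
  PreTopologicalNmodule_isTopologicalNmodule.Build A sn_add_continuous.
HB.instance Definition _ :=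
  TopologicalNmodule_isTopologicalLmodule.Build R[i] A sn_scale_continuous.
HB.instance Definition _ := Uniform_isTvs.Build R[i] A sn_locally_convex.
HB.instance Definition _ :=
  UnitAlgebraTvs_isLocConvAlgebra.Build R[i] A sn_mul_continuous.
HB.end.

(** * Local m-convexity, continuity of inversion, separation and metrizability *)

Section SeminormTopology.
Variables (R : realType) (A : locConvAlgType R[i]) (p : nat -> A -> R).
Hypothesis hp : seminorm_system p.
Hypothesis nbhsA : forall (x : A) (U : set A), nbhs x U <->
  exists n, exists2 e : R, 0 < e & [set y | p n (x - y) < e] `<=` U.

Lemma sn_locally_m_convex : locally_m_convex A.
Proof.
exists (range p); split.
  move=> _ [n _ <-]; split; first split=> [|c] *.
  - exact: (snD hp).
  - by rewrite Re_normr (snZ hp).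
  - by move=> x y; exact: (snM hp).
move=> x U; split.
  move=> /nbhsA[n [e e0 eU]]; exists [set p n], e; split => //.
    by move=> _ ->; exists n.
  by move=> y /(_ _ erefl); rewrite (snB hp); exact: eU.
move=> [F [e [Ffin Fp e0 eU]]].
(* Finitely many members of an increasing sequence are dominated by the one of largest index. *)
have [N FN] : exists N, forall q, F q -> exists2 n, (n <= N)%N & q = p n.
  have /finite_seqP[s sF] := Ffin; rewrite sF in Fp *.
  elim: s Fp {sF} => [|q s IH] sp; first by exists 0%N.
  have [m _ qE] := sp q (mem_head _ _).
  have [N hN] := IH (fun r rs => sp r (@mem_behead _ (q :: s) r rs)).
  exists (maxn m N) => r /=; rewrite inE => /orP[/eqP->|/hN[k kN ->]].
    by exists m; rewrite ?leq_maxl.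
  by exists k => //; rewrite (leq_trans kN) ?leq_maxr.
apply/nbhsA; exists N, e => // y xy; apply: eU => q /FN[n nN ->].
by rewrite (snB hp) (le_lt_trans (sn_mono hp _ nN)).
Qed.

Lemma sn_inversion_continuous : inversion_continuous A.
Proof.
apply/subspace_continuousP => x ux U /nbhsA[n [e e0 eU]].
have [d d0 H] := sn_inv_near hp n e0 ux.
rewrite /within /=; apply/nbhsA; exists n, d => // y xy uy.
by apply: eU; apply: H.
Qed.

Hypothesis p_sep : forall x, (forall n, p n x = 0) -> x = 0.

Lemma sn_hausdorff : hausdorff_space A.
Proof.
move=> x y xy; apply/eqP; rewrite -subr_eq0; apply/eqP/p_sep => n.
apply/eqP; rewrite eq_le (sn_ge0 hp) andbT leNgt; apply/negP => e0.
have h z : nbhs z [set w | p n (z - w) < p n (x - y) / 2].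
  by apply/nbhsA; exists n, (p n (x - y) / 2) => //; rewrite divr_gt0.
have [z [/= xz yz]] := xy _ _ (h x) (h y).
have := sn_triangle hp n x z y; rewrite leNgt => /negP; apply.
by rewrite [ltRHS]splitr ltrD// (snB hp).
Qed.

(** The metric is the infimum over [n] of [2^-n + p n (x - y)]. Small distance forces a large index,
    which controls every earlier seminorm; conversely a large [n] with [p n (x - y)] small makes the
    distance small. *)
Lemma sn_metrizable : metrizable R A.
Proof.
pose D x y := [set (2^-1) ^+ n + p n (x - y) | n in [set: nat]].
have D0 x y : has_inf (D x y).
  split; first by exists ((2^-1) ^+ 0 + p 0 (x - y)), 0%N.
  by exists 0 => _ [n _ <-]; rewrite addr_ge0 ?(sn_ge0 hp).
pose d x y := inf (D x y).
have le_d n x y : d x y <= (2^-1) ^+ n + p n (x - y).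
  by apply: ge_inf; [case: (D0 x y)|exists n].
have d_ge x y e : d x y < e -> exists n, (2^-1) ^+ n + p n (x - y) < e.
  by move=> /(inf_lt (D0 x y).1)[_ [n _ <-] ?]; exists n.
have d_ge0 x y : 0 <= d x y.
  by apply: lb_le_inf; [case: (D0 x y)|move=> _ [n _ <-]; rewrite addr_ge0 ?(sn_ge0 hp)].
have small e : 0 < e -> exists n, (2^-1 : R) ^+ n < e.
  move=> e0; have /cvgr_lt/(_ _ e0) : (GRing.exp (2^-1 : R)) @ \oo --> (0 : R).
    by apply: cvg_expr; rewrite ger0_norm ?invf_lt1 ?ltr1n// invr_ge0.
  by move=> [n _ /(_ n (leqnn n))]; exists n.
(* A value below [2^-N] can only come from an index at least [N]. *)
have d_lt N e x y : d x y < Num.min ((2^-1) ^+ N) e -> p N (x - y) < e.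
  move=> /d_ge[n]; rewrite lt_min => /andP[h1 h2].
  have Nn : (N <= n)%N.
    rewrite leqNgt; apply/negP => nN.
    have : (2^-1 : R) ^+ n < (2^-1) ^+ N.
      by apply: le_lt_trans h1; rewrite lerDl (sn_ge0 hp).
    by rewrite ltNge ler_wiXn2l // ?invr_ge0// ?invf_le1 ?ler1n// ltnW.
  rewrite (le_lt_trans (sn_mono hp _ Nn))// (le_lt_trans _ h2)//.
  by rewrite lerDr exprn_ge0.
exists d; split.
- move=> x y; split => [dxy|->]; last first.
    apply/eqP; rewrite eq_le d_ge0 andbT leNgt; apply/negP => /small[n].
    by rewrite ltNge => /negP; apply; rewrite (le_trans (le_d n _ _))// subrr (sn0 hp) addr0.
  apply/eqP; rewrite -subr_eq0; apply/eqP/p_sep => n.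
  apply/eqP; rewrite eq_le (sn_ge0 hp) andbT leNgt; apply/negP => e0.
  have := @d_lt n (p n (x - y)) x y; rewrite dxy lt_min e0 exprn_gt0//= ltxx.
  by move=> /(_ isT).
- by move=> x y; rewrite /d /D; under eq_fun do rewrite (snB hp).
(* Near-optimal indices [n] and [m] for the two sides are compared at their minimum: there the
   seminorms are smaller, and the power of 1/2 is one of the two already counted. *)
- move=> x y z; rewrite leNgt; apply/negP => h.
  have : d x y < d x z - d y z by rewrite ltrBrDr.
  move=> /d_ge[n hn]; have : d y z < d x z - ((2^-1) ^+ n + p n (x - y)) by lra.
  move=> /d_ge[m hm].
  have := le_d (minn n m) x z; have := sn_triangle hp (minn n m) x y z.
  have := sn_mono hp (x - y) (geq_minl n m); have := sn_mono hp (y - z) (geq_minr n m).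
  have : (2^-1 : R) ^+ minn n m <= (2^-1) ^+ n + (2^-1) ^+ m.
    by case: leqP => _; rewrite ?lerDl ?lerDr exprn_ge0.
  lra.
- move=> x U; split.
    move=> /nbhsA[n [e e0 eU]]; exists (Num.min ((2^-1) ^+ n) e).
      by rewrite lt_min e0 exprn_gt0.
    by move=> y /d_lt; exact: eU.
  move=> [e e0 eU]; have [|n hn] := small (e / 2); first by rewrite divr_gt0.
  apply/nbhsA; exists n, (e / 2); first by rewrite divr_gt0.
  move=> y /= xy; apply: eU; rewrite /= (le_lt_trans (le_d n _ _))//.
  by rewrite [ltRHS]splitr ltrD.
Qed.

End SeminormTopology.

(** * Infinite upper triangular matrices *)

(* [f i l] is the entry in row [i] and column [i + l]. *)
Definition utmx (K : Type) : Type := nat -> nat -> K.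

(** Both sides run over the pairs [(k, m)] with [k + m < n], by antidiagonals on the left and by
    rows on the right. Associativity and submultiplicativity both rest on this exchange. *)
Lemma sum_triangle (V : nmodType) (F : nat -> nat -> V) n :
  \sum_(j < n) \sum_(k < j.+1) F k (j - k)%N =
  \sum_(k < n) \sum_(m < n - k) F k m.
Proof.
elim: n => [|n IH]; first by rewrite !big_ord0.
rewrite big_ord_recr /= IH [RHS]big_ord_recr /= subSnn big_ord1.
rewrite [X in _ + X]big_ord_recr /= subnn addrA -big_split /=; congr (_ + _).
by apply: eq_bigr => k _; rewrite subSn ?big_ord_recr// ltnW.
Qed.

Section UtmxAlgebra.
Variable K : comNzRingType.
Implicit Types f g h : utmx K.

HB.instance Definition _ := GRing.Zmodule.copy (utmx K) (nat -> nat -> K).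

Definition utmx_scale (c : K) f : utmx K := fun i l => c * f i l.

Lemma utmxP f g : (forall i l, f i l = g i l) -> f = g.
Proof. by move=> fg; apply/funext => i; apply/funext. Qed.

Fact utmx_scaleA a b f : utmx_scale a (utmx_scale b f) = utmx_scale (a * b) f.
Proof. by apply: utmxP => i l; rewrite /utmx_scale mulrA. Qed.
Fact utmx_scale1 : left_id 1 utmx_scale.
Proof. by move=> f; apply: utmxP => i l; rewrite /utmx_scale mul1r. Qed.
Fact utmx_scaleDr : right_distributive utmx_scale +%R.
Proof. by move=> a f g; apply: utmxP => i l; rewrite /utmx_scale mulrDr. Qed.
Fact utmx_scaleDl f : {morph utmx_scale^~ f : a b / a + b}.
Proof. by move=> a b; apply: utmxP => i l; rewrite /utmx_scale mulrDl. Qed.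

HB.instance Definition _ := GRing.Zmodule_isLmodule.Build K (utmx K)
  utmx_scaleA utmx_scale1 utmx_scaleDr utmx_scaleDl.

Definition utmx_one : utmx K := fun _ l => (l == 0%N)%:R.
Definition utmx_mul f g : utmx K :=
  fun i l => \sum_(k < l.+1) f i k * g (i + k)%N (l - k)%N.

Fact utmx_mulA : associative utmx_mul.
Proof.
move=> f g h; apply: utmxP => i l; rewrite /utmx_mul.
(* The inner range is rewritten from [(l - k).+1] to [l.+1 - k], the form in which [sum_triangle]
   applies. *)
under eq_bigr => k _ do rewrite mulr_sumr -subSn ?leq_ord//.
rewrite -(sum_triangle (fun k m =>
  f i k * (g (i + k)%N m * h (i + k + m)%N (l - k - m)%N)) l.+1).
apply: eq_bigr => j _; rewrite mulr_suml; apply: eq_bigr => k _.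
by rewrite mulrA -addnA -subnDA subnKC ?leq_ord.
Qed.

Fact utmx_mul1r : left_id utmx_one utmx_mul.
Proof.
move=> f; apply: utmxP => i l; rewrite /utmx_mul big_ord_recl big1 => [|k _].
  by rewrite mul1r addr0 addn0 subn0.
by rewrite mul0r.
Qed.

Fact utmx_mulr1 : right_id utmx_one utmx_mul.
Proof.
move=> f; apply: utmxP => i l; rewrite /utmx_mul big_ord_recr big1 => [|k _] /=.
  by rewrite /utmx_one subnn mulr1 add0r.
by rewrite /utmx_one subn_eq0 leqNgt ltn_ord mulr0.
Qed.

Fact utmx_mulDl : left_distributive utmx_mul +%R.
Proof.
move=> f g h; apply: utmxP => i l.
rewrite -[RHS]/(utmx_mul f h i l + utmx_mul g h i l) /utmx_mul -big_split.
by apply: eq_bigr => k _; exact: mulrDl.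
Qed.

Fact utmx_mulDr : right_distributive utmx_mul +%R.
Proof.
move=> f g h; apply: utmxP => i l.
rewrite -[RHS]/(utmx_mul f g i l + utmx_mul f h i l) /utmx_mul -big_split.
by apply: eq_bigr => k _; exact: mulrDr.
Qed.

Fact utmx_oner_neq0 : utmx_one != 0.
Proof.
by apply/eqP => /(congr1 (fun f => f 0%N 0%N))/eqP; rewrite oner_eq0.
Qed.

HB.instance Definition _ := GRing.Zmodule_isNzRing.Build (utmx K)
  utmx_mulA utmx_mul1r utmx_mulr1 utmx_mulDl utmx_mulDr utmx_oner_neq0.

Fact utmx_scaleAl (a : K) f g : a *: (f * g) = a *: f * g.
Proof.
apply: utmxP => i l; rewrite /GRing.scale /= /utmx_scale mulr_sumr.
by apply: eq_bigr => k _; rewrite mulrA.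
Qed.

HB.instance Definition _ := GRing.Lmodule_isLalgebra.Build K (utmx K) utmx_scaleAl.

Fact utmx_scaleAr (a : K) f g : a *: (f * g) = f * (a *: g).
Proof.
apply: utmxP => i l; rewrite /GRing.scale /= /utmx_scale mulr_sumr.
by apply: eq_bigr => k _; rewrite mulrCA.
Qed.

HB.instance Definition _ := GRing.Lalgebra_isAlgebra.Build K (utmx K) utmx_scaleAr.

Lemma utmxDE f g i l : (f + g) i l = f i l + g i l. Proof. by []. Qed.
Lemma utmxNE f i l : (- f) i l = - f i l. Proof. by []. Qed.
Lemma utmxZE (a : K) f i l : (a *: f) i l = a * f i l. Proof. by []. Qed.
Lemma utmx0E i l : (0 : utmx K) i l = 0. Proof. by []. Qed.
Lemma utmx1E i l : (1 : utmx K) i l = (l == 0%N)%:R. Proof. by []. Qed.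
Lemma utmxME f g i l :
  (f * g) i l = \sum_(k < l.+1) f i k * g (i + k)%N (l - k)%N.
Proof. by []. Qed.
Definition utmxE := (utmxDE, utmxNE, utmxZE, utmx0E, utmx1E).

Lemma utmxM0E f g i : (f * g) i 0%N = f i 0%N * g i 0%N.
Proof. by rewrite utmxME big_ord1 addn0. Qed.

Definition blkdiag k f : utmx K :=
  fun i l => if ((i + l) %/ 2 ^ k == i %/ 2 ^ k)%N then f i l else 0.

Lemma blkdiagD k f g : blkdiag k (f + g) = blkdiag k f + blkdiag k g.
Proof.
by apply: utmxP => i l; rewrite utmxE /blkdiag; case: ifP; rewrite ?addr0.
Qed.

Lemma blkdiagZ k (a : K) f : blkdiag k (a *: f) = a *: blkdiag k f.
Proof.
by apply: utmxP => i l; rewrite utmxE /blkdiag; case: ifP; rewrite ?mulr0.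
Qed.

Lemma blkdiagN k f : blkdiag k (- f) = - blkdiag k f.
Proof. by rewrite -!scaleN1r blkdiagZ. Qed.

Lemma blkdiag1 k : blkdiag k 1 = 1.
Proof.
apply: utmxP => i [|l]; rewrite /blkdiag !utmxE ?addn0 ?eqxx//=.
by case: ifP.
Qed.

(** Triangularity makes truncation multiplicative. The intermediate index [i + j] lies between [i]
    and [i + l], so it shares their block whenever they lie in a common one; if they do not, one of
    the two factors crosses a boundary. *)
Lemma blkdiagM k f g : blkdiag k (f * g) = blkdiag k f * blkdiag k g.
Proof.
apply: utmxP => i l; rewrite /blkdiag !utmxME.
case: ifPn => [/eqP il|il].
  apply: eq_bigr => [[j /= jl] _].
  suff -> : ((i + j) %/ 2 ^ k = i %/ 2 ^ k)%N by rewrite -addnA subnKC// il !eqxx.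
  apply/eqP; rewrite eqn_leq [X in _ && X]leq_div2r ?leq_addr// andbT.
  by rewrite -[leqRHS]il leq_div2r// leq_add2l.
rewrite big1// => [[j /= jl] _].
case: ifP => [/eqP ij|]; last by rewrite mul0r.
by rewrite -addnA subnKC// ij (negbTE il) mulr0.
Qed.

(** Blocks are nested because [2 ^ k] divides [2 ^ k']. This lets two block-diagonal matrices be
    given a common block size. *)
Lemma blkdiag_le k k' f : (k <= k')%N -> blkdiag k f = f -> blkdiag k' f = f.
Proof.
move=> kk' fk; apply: utmxP => i l; rewrite -fk /blkdiag.
have [il|_] := eqVneq ((i + l) %/ 2 ^ k)%N (i %/ 2 ^ k)%N; last by case: ifP.
by rewrite -(subnKC kk') expnD !divnMA il eqxx.
Qed.

Lemma blkdiagK k f : blkdiag k (blkdiag k f) = blkdiag k f.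
Proof. by apply: utmxP => i l; rewrite /blkdiag; case: (_ == _). Qed.

Lemma blkdiag_far k f i l : blkdiag k f = f -> (2 ^ k <= l)%N -> f i l = 0.
Proof.
move=> <- kl; rewrite /blkdiag; case: ifPn => // /eqP il.
have : (i + 2 ^ k <= i + l)%N by rewrite leq_add2l.
move=> /(leq_div2r (2 ^ k)); rewrite il divnDr ?dvdnn// divnn expn_gt0/=.
by rewrite addn1 ltnn.
Qed.

(** Each factor with zero diagonal moves at least one column to the right. *)
Lemma utmx_exp_low f m i l : (forall i, f i 0%N = 0) -> (l < m)%N -> (f ^+ m) i l = 0.
Proof.
move=> f0; elim: m i l => // m IH i l lm; rewrite exprS utmxME big1// => k _.
have [k0|k0] := posnP k; first by rewrite k0 f0 mul0r.
rewrite IH ?mulr0//; case: l lm k k0 => [|l] lm k k0; last by lia.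
by case: k k0 => [[]].
Qed.

(** The power vanishes at offsets below [2 ^ k] because the diagonal of [f] is zero, and at the
    others because it is still block diagonal. *)
Lemma blkdiag_nilp k f :
  blkdiag k f = f -> (forall i, f i 0%N = 0) -> f ^+ (2 ^ k) = 0.
Proof.
move=> fk f0; apply: utmxP => i l.
have [lk|kl] := ltnP l (2 ^ k); first exact: utmx_exp_low.
apply: blkdiag_far kl; elim: (2 ^ k)%N => [|m IH]; first by rewrite expr0 blkdiag1.
by rewrite exprS blkdiagM IH fk.
Qed.

End UtmxAlgebra.

(** * Inverses in an arbitrary ring by classical choice *)

HB.factory Record NzRing_isClassicalUnitRing A & GRing.NzRing A := {}.

HB.builders Context A & NzRing_isClassicalUnitRing A.

Definition inverse_of (x : A) : set A := [set y | y * x = 1 /\ x * y = 1].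
Definition classical_unit (x : A) : bool := `[< inverse_of x !=set0 >].
Definition classical_inv (x : A) : A := xget x (inverse_of x).

Lemma classical_invP x : classical_unit x -> inverse_of x (classical_inv x).
Proof. by move=> /asboolP[y xy]; apply: xgetPex; exists y. Qed.

Lemma classical_mulVr : {in classical_unit, left_inverse 1 classical_inv *%R}.
Proof. by move=> x /classical_invP[]. Qed.

Lemma classical_divrr : {in classical_unit, right_inverse 1 classical_inv *%R}.
Proof. by move=> x /classical_invP[]. Qed.

Lemma classical_unitrP x y : y * x = 1 /\ x * y = 1 -> classical_unit x.
Proof. by move=> xy; apply/asboolP; exists y. Qed.

Lemma classical_inv_out : {in [predC classical_unit], classical_inv =1 id}.
Proof.
move=> x /asboolP ux; rewrite /classical_inv; case: xgetP => // y _ xy.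
by case: ux; exists y.
Qed.

HB.instance Definition _ := GRing.NzRing_hasMulInverse.Build A
  classical_mulVr classical_divrr classical_unitrP classical_inv_out.

HB.end.

(** * Weighted row sums and the matrices of the completion *)

Section RowSums.
Variable R : realType.
Implicit Types f g : utmx R[i].

(** Rows are truncated at length [m], so every estimate concerns finite sums; the supremum in
    [wnorm] is later taken over [i] and [m] together, and no series occurs. *)
Definition rowsum n f i m : R := \sum_(l < m) normc (f i l) * n.+1%:R ^+ l.

Lemma rowsum_term_ge0 n f i l : 0 <= normc (f i l) * n.+1%:R ^+ l.
Proof. by rewrite mulr_ge0 ?normc_ge0// exprn_ge0. Qed.

Lemma rowsum_ge0 n f i m : 0 <= rowsum n f i m.
Proof. by apply: sumr_ge0 => l _; exact: rowsum_term_ge0. Qed.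

Lemma rowsum_entry n f i l : normc (f i l) * n.+1%:R ^+ l <= rowsum n f i l.+1.
Proof. by rewrite /rowsum big_ord_recr lerDr rowsum_ge0. Qed.

Lemma rowsum0 n i m : rowsum n 0 i m = 0.
Proof. by apply: big1 => l _; rewrite utmx0E normc0 mul0r. Qed.

Lemma rowsumD n f g i m : rowsum n (f + g) i m <= rowsum n f i m + rowsum n g i m.
Proof.
rewrite -big_split; apply: ler_sum => l _ /=.
by rewrite -mulrDl ler_wpM2r ?exprn_ge0// le_normcD.
Qed.

Lemma rowsumZ n (c : R[i]) f i m : rowsum n (c *: f) i m = normc c * rowsum n f i m.
Proof. by rewrite mulr_sumr; apply: eq_bigr => l _; rewrite utmxZE normcM mulrA. Qed.

Lemma rowsumN n f i m : rowsum n (- f) i m = rowsum n f i m.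
Proof. by apply: eq_bigr => l _; rewrite utmxNE normcN. Qed.

Lemma rowsum_leS n f i m : rowsum n f i m <= rowsum n.+1 f i m.
Proof.
apply: ler_sum => l _; rewrite ler_wpM2l ?normc_ge0//.
by rewrite lerXn2r ?nnegrE ?ler_nat.
Qed.

Lemma rowsum_normc_le n f g i m : (forall l, normc (f i l) <= normc (g i l)) ->
  rowsum n f i m <= rowsum n g i m.
Proof. by move=> fg; apply: ler_sum => l _; rewrite ler_wpM2r ?exprn_ge0. Qed.

Lemma rowsum_blkdiag n k f i m : rowsum n (blkdiag k f) i m <= rowsum n f i m.
Proof.
by apply: rowsum_normc_le => l; rewrite /blkdiag; case: ifP; rewrite // normc0 normc_ge0.
Qed.

(** A boundary between larger blocks is also one between smaller blocks, so enlarging the blocks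
    discards fewer entries. Hence an approximation at [k] remains valid at every larger index. *)
Lemma rowsum_blkdiagB n k k' f i m : (k <= k')%N ->
  rowsum n (f - blkdiag k' f) i m <= rowsum n (f - blkdiag k f) i m.
Proof.
move=> kk'; apply: rowsum_normc_le => l; rewrite !utmxE /blkdiag.
case: ifPn => [_|il']; first by rewrite subrr normc0 normc_ge0.
case: ifPn => [/eqP il|//]; move: il'.
by rewrite -(subnKC kk') expnD !divnMA il eqxx.
Qed.

Lemma normc_sum I (r : seq I) (F : I -> R[i]) :
  normc (\sum_(i <- r) F i) <= \sum_(i <- r) normc (F i).
Proof.
elim/big_ind2: _ => //; first by rewrite normc0.
by move=> x a y b xa yb; rewrite (le_trans (le_normcD _ _))// lerD.
Qed.

(** The weights are multiplicative in the offset, so after [sum_triangle] the inner sums are row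
    sums of [g] in the rows [i + k]. This is why [g] is bounded in all rows and [f] only in row
    [i]. *)
Lemma rowsumM n f g i m a b : (forall m, rowsum n f i m <= a) ->
  (forall i m, rowsum n g i m <= b) -> rowsum n (f * g) i m <= a * b.
Proof.
move=> fa gb; pose F k j := normc (f i k) * n.+1%:R ^+ k *
  (normc (g (i + k)%N j) * n.+1%:R ^+ j).
have b0 : 0 <= b by rewrite (le_trans (rowsum_ge0 n g 0 0)).
rewrite (@le_trans _ _ (\sum_(l < m) \sum_(k < l.+1) F k (l - k)%N))//.
  apply: ler_sum => l _; rewrite utmxME.
  rewrite (le_trans (ler_wpM2r _ (normc_sum _ _))) ?exprn_ge0//.
  rewrite mulr_suml ler_sum// => k _; rewrite normcM /F mulrACA -exprD.
  by rewrite subnKC// leq_ord.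
rewrite sum_triangle (@le_trans _ _ (rowsum n f i m * b)) ?ler_wpM2r//.
rewrite mulr_suml ler_sum// => k _; rewrite -mulr_sumr.
by rewrite ler_wpM2l ?rowsum_term_ge0//; exact: gb.
Qed.

Lemma rowsum1 n i m : rowsum n 1 i m <= 1.
Proof.
case: m => [|m]; first by rewrite /rowsum big_ord0.
rewrite /rowsum big_ord_recl big1 => [|l _]; last by rewrite utmx1E normc0 mul0r.
by rewrite utmx1E normc1 mul1r expr0 addr0.
Qed.

Definition bounded_rows f := forall n, exists M, forall i m, rowsum n f i m <= M.

(** On an unbounded set [sup] is a default value, so row sums are compared with [wnorm] only under
    [bounded_rows]. *)
Definition wnorm n f : R := sup (range (fun im => rowsum n f im.1 im.2)).

Lemma wnorm_le n f M : (forall i m, rowsum n f i m <= M) -> wnorm n f <= M.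
Proof.
move=> fM; apply: ge_sup; first by exists (rowsum n f 0 0), (0%N, 0%N).
by move=> _ [[i m] _ <-].
Qed.

Lemma rowsum_wnorm n f i m : bounded_rows f -> rowsum n f i m <= wnorm n f.
Proof.
move=> /(_ n)[M fM]; apply: ub_le_sup; last by exists (i, m).
by exists M => _ [[j k] _ <-].
Qed.

Definition blkdiag_approx f := forall n (e : R), 0 < e ->
  exists k, forall i m, rowsum n (f - blkdiag k f) i m <= e.

(** The completion is described concretely, as matrices approximable by their own truncations; the
    block size may depend on the weight [n] and on the precision. *)
Record in_bhat f : Prop := InBhat {
  bhat_bounded : bounded_rows f;
  bhat_diag : forall i, f i 0%N = f 0%N 0%N;
  bhat_approx : blkdiag_approx f }.

Lemma in_bhat1 : in_bhat 1.
Proof.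
split=> // [n|n e e0]; first by exists 1; exact: rowsum1.
by exists 0%N => i m; rewrite blkdiag1 subrr rowsum0 ltW.
Qed.

Lemma in_bhatD f g : in_bhat f -> in_bhat g -> in_bhat (f + g).
Proof.
move=> [bf df af] [bg dg ag]; split=> [n|i|n e e0]; last 2 first.
- by rewrite !utmxE df dg.
- have e20 : 0 < e / 2 by rewrite divr_gt0.
  have [k fk] := af n _ e20; have [k' gk'] := ag n _ e20.
  exists (maxn k k') => i m; rewrite blkdiagD opprD addrACA.
  rewrite (le_trans (rowsumD _ _ _ _ _))// [leRHS]splitr lerD//.
    by rewrite (le_trans _ (fk i m))// rowsum_blkdiagB ?leq_maxl.
  by rewrite (le_trans _ (gk' i m))// rowsum_blkdiagB ?leq_maxr.
have [M fM] := bf n; have [N gN] := bg n; exists (M + N) => i m.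
by rewrite (le_trans (rowsumD _ _ _ _ _))// lerD.
Qed.

Lemma in_bhatZ (c : R[i]) f : in_bhat f -> in_bhat (c *: f).
Proof.
have c0 := normc_ge0 c; move=> [bf df af]; split=> [n|i|n e e0].
- have [M fM] := bf n; exists (normc c * M) => i m.
  by rewrite rowsumZ ler_wpM2l.
- by rewrite !utmxE df.
- have [|k fk] := af n (e / (normc c + 1)); first by rewrite divr_gt0// ltr_wpDl.
  exists k => i m; rewrite blkdiagZ -scalerBr rowsumZ.
  rewrite (@le_trans _ _ ((normc c + 1) * (e / (normc c + 1))))//.
    by rewrite ler_pM ?rowsum_ge0// lerDl.
  by rewrite mulrC divfK// lt0r_neq0// ltr_wpDl.
Qed.

Lemma in_bhatM f g : in_bhat f -> in_bhat g -> in_bhat (f * g).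
Proof.
move=> [bf df af] [bg dg ag]; split=> [n|i|n e e0].
- have [M fM] := bf n; have [N gN] := bg n; exists (M * N) => i m.
  exact: rowsumM.
- by rewrite !utmxM0E df dg.
have [M fM] := bf n; have [N gN] := bg n.
have M0 : 0 <= M by rewrite (le_trans (rowsum_ge0 n f 0 0)).
have N0 : 0 <= N by rewrite (le_trans (rowsum_ge0 n g 0 0)).
have K0 : 0 < M + N + 1 by lra.
have d0 : 0 < e / (M + N + 1) by rewrite divr_gt0.
have [k fk] := af n _ d0; have [k' gk'] := ag n _ d0.
set d := e / _ in d0 fk gk'; exists (maxn k k') => i m; set j := maxn k k'.
(* Since truncation is multiplicative, the error of a product splits like the difference of two
   products. *)
have -> : f * g - blkdiag j (f * g) =
    (f - blkdiag j f) * g + blkdiag j f * (g - blkdiag j g).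
  by rewrite blkdiagM mulrBl mulrBr addrA subrK.
rewrite (le_trans (rowsumD _ _ _ _ _))// (@le_trans _ _ (d * N + M * d))//.
  apply: lerD; apply: rowsumM => //.
  - by move=> p; rewrite (le_trans _ (fk i p))// rowsum_blkdiagB ?leq_maxl.
  - by move=> p; rewrite (le_trans (rowsum_blkdiag _ _ _ _ _)).
  - by move=> p q; rewrite (le_trans _ (gk' p q))// rowsum_blkdiagB ?leq_maxr.
have -> : e = d * (M + N + 1) by rewrite divfK// gt_eqF.
by rewrite [M * d]mulrC -mulrDr ler_wpM2l ?ltW//; lra.
Qed.

Lemma in_bhat_blkdiag k f : in_bhat f -> in_bhat (blkdiag k f).
Proof.
move=> [bf df af]; split=> [n|i|n e e0].
- by have [M fM] := bf n; exists M => i m; rewrite (le_trans (rowsum_blkdiag _ _ _ _ _)).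
- by rewrite /blkdiag !addn0 !eqxx df.
- by exists k => i m; rewrite blkdiagK subrr rowsum0 ltW.
Qed.

Definition bhat_pred : {pred utmx R[i]} := fun f => `[< in_bhat f >].

Lemma bhat_predP f : reflect (in_bhat f) (f \in bhat_pred).
Proof. exact: asboolP. Qed.

Fact bhat_closed : GRing.subsemialg_closed bhat_pred.
Proof.
split; first exact/bhat_predP/in_bhat1.
- split; first by apply/bhat_predP; rewrite -(scale0r 1); exact/in_bhatZ/in_bhat1.
  by move=> f g /bhat_predP hf /bhat_predP hg; apply/bhat_predP/in_bhatD.
- by move=> c f /bhat_predP hf; apply/bhat_predP/in_bhatZ.
- by move=> f g /bhat_predP hf /bhat_predP hg; apply/bhat_predP/in_bhatM.
Qed.

End RowSums.

(** * The algebra and its completion *)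

Section Algebras.
Variable R : realType.

Record bhat : Type := Bhat { bhat_val : utmx R[i]; _ : bhat_val \in @bhat_pred R }.

HB.instance Definition _ := [isSub for bhat_val].
HB.instance Definition _ := [Choice of bhat by <:].
HB.instance Definition _ :=
  GRing.SubChoice_isSubAlgebra.Build R[i] _ _ bhat (bhat_closed R).
HB.instance Definition _ := NzRing_isClassicalUnitRing.Build bhat.

Lemma bhatP (f : bhat) : in_bhat (\val f).
Proof. exact/bhat_predP/valP. Qed.

Lemma bhat_valD (f g : bhat) : \val (f + g) = \val f + \val g.
Proof. exact: raddfD. Qed.

Lemma bhat_valB (f g : bhat) : \val (f - g) = \val f - \val g.
Proof. exact: raddfB. Qed.

Lemma bhat_valZ (c : R[i]) (f : bhat) : \val (c *: f) = c *: \val f.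
Proof. exact: linearZ. Qed.

Lemma bhat_valM (f g : bhat) : \val (f * g) = \val f * \val g.
Proof. exact: rmorphM. Qed.

Lemma wnorm_ge0 n (f : bhat) : 0 <= wnorm n (\val f).
Proof.
by rewrite (le_trans (rowsum_ge0 n (\val f) 0 0))// rowsum_wnorm//; case: (bhatP f).
Qed.

Lemma wnorm_system : seminorm_system (fun n (f : bhat) => wnorm n (\val f)).
Proof.
have le_wnorm n (f : bhat) i m : rowsum n (\val f) i m <= wnorm n (\val f).
  by apply: rowsum_wnorm; case: (bhatP f).
split=> [n f|n f g|n c f|n f g].
- by apply: wnorm_le => i m; rewrite (le_trans (rowsum_leS _ _ _ _)).
- by apply: wnorm_le => i m; rewrite bhat_valD (le_trans (rowsumD _ _ _ _ _))// lerD.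
- apply/eqP; rewrite eq_le; apply/andP; split.
    by apply: wnorm_le => i m; rewrite bhat_valZ rowsumZ ler_wpM2l ?normc_ge0.
  (* The reverse inequality bounds each row sum of [f] by that of [c *: f] divided by [normc c], so
     [c = 0] is treated apart. *)
  have [->|c0] := eqVneq c 0; first by rewrite normc0 mul0r wnorm_ge0.
  have nc0 : 0 < normc c.
    by rewrite lt0r normc_ge0 andbT; apply: contra_neq c0 => /eq0_normc.
  rewrite mulrC -ler_pdivlMr//; apply: wnorm_le => i m.
  by rewrite ler_pdivlMr// mulrC -rowsumZ -bhat_valZ.
- by apply: wnorm_le => i m; rewrite bhat_valM; apply: rowsumM => *; exact: le_wnorm.
Qed.

HB.instance Definition _ := UnitAlgebra_isSeminormed.Build R bhat wnorm_system.

Lemma nbhs_bhat (x : bhat) (U : set bhat) : nbhs x U <->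
  exists n, exists2 e : R, 0 < e & [set y | wnorm n (\val (x - y)) < e] `<=` U.
Proof. exact: (nbhs_sn_entourage (fun n (f : bhat) => wnorm n (\val f))). Qed.

Definition bloc_pred : {pred bhat} :=
  fun f => `[< exists k, blkdiag k (\val f) = \val f >].

Fact bloc_closed : GRing.subsemialg_closed bloc_pred.
Proof.
have two (f g : bhat) : f \in bloc_pred -> g \in bloc_pred -> exists k,
    blkdiag k (\val f) = \val f /\ blkdiag k (\val g) = \val g.
  move=> /asboolP[k fk] /asboolP[k' gk']; exists (maxn k k'); split.
    exact: blkdiag_le (leq_maxl _ _) fk.
  exact: blkdiag_le (leq_maxr _ _) gk'.
have scaleP (c : R[i]) (f : bhat) : f \in bloc_pred -> c *: f \in bloc_pred.
  by move=> /asboolP[k fk]; apply/asboolP; exists k; rewrite bhat_valZ blkdiagZ fk.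
have oneP : 1 \in bloc_pred.
  by apply/asboolP; exists 0%N; rewrite rmorph1 blkdiag1.
split=> //.
- split; first by rewrite -(scale0r 1); exact: scaleP.
  move=> f g hf hg; have [k [fk gk]] := two _ _ hf hg.
  by apply/asboolP; exists k; rewrite bhat_valD blkdiagD fk gk.
- move=> f g hf hg; have [k [fk gk]] := two _ _ hf hg.
  by apply/asboolP; exists k; rewrite bhat_valM blkdiagM fk gk.
Qed.

Record bloc : Type := Bloc { bloc_val : bhat; _ : bloc_val \in bloc_pred }.

HB.instance Definition _ := [isSub for bloc_val].
HB.instance Definition _ := [Choice of bloc by <:].
HB.instance Definition _ :=
  GRing.SubChoice_isSubAlgebra.Build R[i] _ _ bloc bloc_closed.
HB.instance Definition _ := NzRing_isClassicalUnitRing.Build bloc.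

Lemma bloc_system : seminorm_system (fun n (f : bloc) => wnorm n (\val (\val f))).
Proof.
split=> [n f|n f g|n c f|n f g].
- exact: (sn_leS wnorm_system).
- exact: (snD wnorm_system n (\val f) (\val g)).
- exact: (snZ wnorm_system n c (\val f)).
- exact: (snM wnorm_system n (\val f) (\val g)).
Qed.

HB.instance Definition _ := UnitAlgebra_isSeminormed.Build R bloc bloc_system.

Lemma nbhs_bloc (x : bloc) (U : set bloc) : nbhs x U <->
  exists n, exists2 e : R, 0 < e & [set y | wnorm n (\val (\val (x - y))) < e] `<=` U.
Proof. exact: (nbhs_sn_entourage (fun n (f : bloc) => wnorm n (\val (\val f)))). Qed.

(** At [n = 0] all weights are 1, and this seminorm alone dominates the modulus of every entry. *)
Lemma wnorm_sep (f : bhat) : (forall n, wnorm n (\val f) = 0) -> f = 0.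
Proof.
move=> f0; apply: val_inj; apply: utmxP => i l; apply: eq0_normc.
apply/eqP; rewrite eq_le normc_ge0 andbT -(f0 0%N).
have := rowsum_entry 0 (\val f) i l; rewrite expr1n mulr1 => /le_trans; apply.
by apply: rowsum_wnorm; case: (bhatP f).
Qed.

Lemma bloc_sep (f : bloc) : (forall n, wnorm n (\val (\val f)) = 0) -> f = 0.
Proof. by move=> f0; apply: val_inj; apply: wnorm_sep. Qed.

Definition bloc_incl : bloc -> bhat := \val.

HB.instance Definition _ := GRing.isLinear.Build R[i] bloc bhat *:%R bloc_incl
  (linearP (\val : bloc -> bhat)).
HB.instance Definition _ := GRing.isMonoidMorphism.Build bloc bhat bloc_incl
  (rmorph1 (\val : bloc -> bhat), rmorphM (\val : bloc -> bhat)).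

End Algebras.

(** * Completeness: entrywise limits of Cauchy filters *)

Section ComplexModulus.
Variable R : realType.
Implicit Types z : R[i].

Lemma normcR (a : R) : normc a%:C%C = `|a|.
Proof. by rewrite /normc /= expr0n addr0 sqrtr_sqr. Qed.

Lemma normc_le_ReIm z : normc z <= `|complex.Re z| + `|complex.Im z|.
Proof.
case: z => a b /=; rewrite -[leRHS]ger0_norm ?addr_ge0// -sqrtr_sqr ler_wsqrtr//.
rewrite sqrrD !real_normK ?num_real//.
by rewrite -addrA lerD2l -[leLHS]add0r lerD2r mulrn_wge0 ?mulr_ge0.
Qed.

Lemma Re_le_normc z : `|complex.Re z| <= normc z.
Proof. by case: z => a b /=; rewrite -sqrtr_sqr ler_wsqrtr// lerDl sqr_ge0. Qed.

Lemma Im_le_normc z : `|complex.Im z| <= normc z.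
Proof. by case: z => a b /=; rewrite -sqrtr_sqr ler_wsqrtr// lerDr sqr_ge0. Qed.

Lemma filter_cauchy_real T (F : set_system T) (u : T -> R) : ProperFilter F ->
  (forall e, 0 < e -> exists2 A, F A & forall x y, A x -> A y -> `|u x - u y| < e) ->
  exists a, forall e, 0 < e -> F [set x | `|u x - a| < e].
Proof.
move=> FF uF; have /cauchy_cvg/cvg_ex[a ua] : cauchy (u @ F).
  apply: cauchy_exP => e /uF[A FA Ae]; have [x Ax] := filter_ex FA.
  exists (u x); rewrite nbhs_simpl /=; apply: filterS FA => y Ay /=.
  by rewrite -ball_normE; exact: Ae.
exists a => e e0; have /cvgrPdist_lt/(_ e e0) := ua.
by apply: filterS => x; rewrite distrC.
Qed.

Lemma filter_cauchy_complex T (F : set_system T) (u : T -> R[i]) : ProperFilter F ->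
  (forall e, 0 < e -> exists2 A, F A & forall x y, A x -> A y -> normc (u x - u y) < e) ->
  exists a, forall e, 0 < e -> F [set x | normc (u x - a) < e].
Proof.
move=> FF uF.
have [|a ha] := @filter_cauchy_real _ F (fun x => complex.Re (u x)) FF.
  move=> e /uF[A FA Ae]; exists A => // x y Ax Ay.
  by apply: le_lt_trans (Ae _ _ Ax Ay); rewrite -raddfB; exact: Re_le_normc.
have [|b hb] := @filter_cauchy_real _ F (fun x => complex.Im (u x)) FF.
  move=> e /uF[A FA Ae]; exists A => // x y Ax Ay.
  by apply: le_lt_trans (Ae _ _ Ax Ay); rewrite -raddfB; exact: Im_le_normc.
exists (a +i* b)%C => e e0; have e20 : 0 < e / 2 by rewrite divr_gt0.
apply: filterS (filterI (ha _ e20) (hb _ e20)) => x [/= xa xb].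
rewrite (le_lt_trans (normc_le_ReIm _))// [ltRHS]splitr.
by case: (u x) xa xb => s t /= sa tb; rewrite ltrD.
Qed.

End ComplexModulus.

Section Complete.
Variable R : realType.
Variables (F : set_system (bhat R)).
Hypothesis FF : ProperFilter F.
Hypothesis F_cauchy : forall n (e : R), 0 < e -> exists2 A, F A &
  forall x y, A x -> A y -> wnorm n (\val (x - y)) < e.

Lemma entry_cauchy i l : exists a, forall e, 0 < e ->
  F [set x : bhat R | normc (\val x i l - a) < e].
Proof.
apply: filter_cauchy_complex => e /(F_cauchy 0)[A FA Ae]; exists A => // x y Ax Ay.
apply: le_lt_trans (Ae _ _ Ax Ay).
have := rowsum_entry 0 (\val (x - y)) i l; rewrite expr1n mulr1 bhat_valB !utmxE.
move=> /le_trans; apply; rewrite -bhat_valB; apply: rowsum_wnorm.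
by case: (bhatP (x - y)).
Qed.

Lemma bhat_entrywise_limit : exists f : utmx R[i], forall i l e, 0 < e ->
  F [set x : bhat R | normc (\val x i l - f i l) < e].
Proof.
have /choice[f hf] : forall il : nat * nat, exists a, forall e, 0 < e ->
    F [set x : bhat R | normc (\val x il.1 il.2 - a) < e].
  by move=> il; exact: entry_cauchy.
by exists (fun i l => f (i, l)) => i l e; exact: (hf (i, l)).
Qed.

Section Limit.
Variable f : utmx R[i].
Hypothesis f_lim : forall i l e, 0 < e ->
  F [set x : bhat R | normc (\val x i l - f i l) < e].

(** A truncated row sum involves finitely many entries, so entrywise convergence is enough, without
    uniformity in [i] and [m]. *)
Lemma rowsum_limit n i m e : 0 < e -> F [set x : bhat R | rowsum n (\val x - f) i m < e].
Proof.
elim: m e => [|m IH] e e0.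
  by apply: filterE => x /=; rewrite /rowsum big_ord0.
have w0 : 0 < n.+1%:R ^+ m :> R by rewrite exprn_gt0.
have d0 : 0 < e / 2 / n.+1%:R ^+ m by rewrite !divr_gt0.
have e20 : 0 < e / 2 by rewrite divr_gt0.
apply: filterS (filterI (IH _ e20) (f_lim i m d0)) => x [/= h1 h2].
by rewrite /rowsum big_ord_recr /= [ltRHS]splitr ltrD// -ltr_pdivlMr// !utmxE.
Qed.

(** Uniformity is recovered here: the comparison point [y] depends on [i], [m] and [d], but the
    bound [e] comes from the Cauchy condition and does not. *)
Lemma rowsum_cauchy_limit n e A x i m : F A ->
  (forall x y, A x -> A y -> wnorm n (\val (x - y)) < e) -> A x ->
  rowsum n (\val x - f) i m <= e.
Proof.
move=> FA Ae Ax; apply/ler_addgt0Pr => d d0.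
have [y [/= Ay yd]] := filter_ex (filterI FA (rowsum_limit n i m d0)).
have -> : \val x - f = \val (x - y) + (\val y - f).
  by rewrite bhat_valB addrA subrK.
rewrite (le_trans (rowsumD _ _ _ _ _))// lerD ?ltW//.
rewrite (le_lt_trans _ (Ae _ _ Ax Ay))// rowsum_wnorm//.
by case: (bhatP (x - y)).
Qed.

Lemma in_bhat_limit : in_bhat f.
Proof.
split=> [n|i|n e e0].
- have [A FA A1] := F_cauchy n ltr01; have [x Ax] := filter_ex FA.
  have [M xM] := bhat_bounded (bhatP x) n; exists (1 + M) => i m.
  have -> : f = - (\val x - f) + \val x by rewrite opprB subrK.
  rewrite (le_trans (rowsumD _ _ _ _ _))// rowsumN lerD//.
  exact: rowsum_cauchy_limit A1 Ax.
- apply/eqP; rewrite -subr_eq0; apply/eqP/eq0_normc/eqP.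
  rewrite eq_le normc_ge0 andbT; apply/ler_addgt0Pr => d d0; rewrite add0r.
  have d20 : 0 < d / 2 by rewrite divr_gt0.
  have [x [/= h1 h2]] := filter_ex (filterI (f_lim i 0 d20) (f_lim 0 0 d20)).
  have -> : f i 0%N - f 0%N 0%N = (f i 0%N - \val x i 0%N) + (\val x 0%N 0%N - f 0%N 0%N).
    by rewrite -(bhat_diag (bhatP x) i) addrA subrK.
  by rewrite (le_trans (le_normcD _ _))// [leRHS]splitr lerD ?ltW// normcB.
have e30 : 0 < e / 3 by rewrite divr_gt0.
have [A FA Ae] := F_cauchy n e30; have [x Ax] := filter_ex FA.
have [k xk] := bhat_approx (bhatP x) n e30; exists k => i m.
(* Three terms of size at most [e / 3]; the last is controlled by the first, since truncation does
   not increase row sums. *)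
have -> : f - blkdiag k f = - (\val x - f) + (\val x - blkdiag k (\val x))
    + blkdiag k (\val x - f).
  by rewrite opprB addrA subrK blkdiagD blkdiagN addrA subrK.
have xf := rowsum_cauchy_limit i m FA Ae Ax.
rewrite (le_trans (rowsumD _ _ _ _ _))//.
have := rowsumD n (- (\val x - f)) (\val x - blkdiag k (\val x)) i m.
rewrite rowsumN; have := rowsum_blkdiag n k (\val x - f) i m; have := xk i m.
lra.
Qed.

End Limit.
End Complete.

Lemma bhat_complete (R : realType) : tvs_complete (bhat R).
Proof.
move=> F FF Fc.
have F_cauchy n (e : R) : 0 < e -> exists2 A, F A &
    forall x y, A x -> A y -> wnorm n (\val (x - y)) < e.
  move=> e0; apply: (Fc [set z : bhat R | wnorm n (\val z) < e]).
  apply/nbhs_bhat; exists n, e => // y ye.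
  by rewrite /= -[y]subr0 (snB (wnorm_system R) n y 0).
have [f f_lim] := bhat_entrywise_limit FF F_cauchy.
have /bhat_predP hf := in_bhat_limit FF F_cauchy f_lim.
pose l := Bhat hf; exists l => U /nbhs_bhat[n [e e0 eU]].
(* The limit and the supremum give only a non-strict bound, hence the halved radius. *)
have e20 : 0 < e / 2 by rewrite divr_gt0.
have [A FA Ae] := F_cauchy n _ e20; apply: (filterS _ FA) => x Ax; apply: eU.
apply: (@le_lt_trans _ _ (e / 2)); last by rewrite ltr_pdivrMr ?ltr_pMr ?ltr1n.
apply: wnorm_le => i m; rewrite bhat_valB -rowsumN opprB.
exact: (rowsum_cauchy_limit FF f_lim i m FA Ae Ax).
Qed.

(** * Units of the two algebras and the weighted shift *)

Lemma unitr_1subnilp (A : unitRingType) (x : A) n :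
  x ^+ n = 0 -> 1 - x \is a GRing.unit.
Proof.
move=> xn; pose S := \sum_(i < n) x ^+ i.
have Sx : (1 - x) * S = 1.
  by rewrite -opprB mulNr -subrX1 xn sub0r opprK.
apply/unitrP; exists S; split=> //; rewrite -[RHS]Sx.
apply: commr_sym; apply: commr_sum => i _; apply/commrX.
by apply: commr_sym; apply: commrB; [exact: commr1|exact: commr_refl].
Qed.

Lemma logn2_fact l : (logn 2 l`! <= l)%N.
Proof.
rewrite logn_fact//.
(* Legendre's sum is strengthened by repeating its last term, so that the induction step reduces to:
   twice [l %/ 2 ^ m.+1] is at most [l %/ 2 ^ m]. *)
suff H m : (\sum_(1 <= k < m.+1) l %/ 2 ^ k + l %/ 2 ^ m <= l)%N.
  by rewrite (leq_trans _ (H l))// leq_addr.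
elim: m => [|m IH]; first by rewrite big_geq// expn0 divn1.
rewrite big_nat_recr//= (leq_trans _ IH)// -addnA leq_add2l addnn -muln2.
by rewrite expnSr divnMA leq_trunc_div.
Qed.

Section Units.
Variable R : realType.

(** With [c] the diagonal value, [1 - c^-1 *: f] is block diagonal with zero diagonal, hence
    nilpotent, and a geometric sum inverts [c^-1 *: f]. *)
Lemma bloc_unit (f : bloc R) : \val (\val f) 0%N 0%N != 0 -> f \is a GRing.unit.
Proof.
set c := \val (\val f) 0%N 0%N => c0; pose g := 1 - c^-1 *: f.
have gE : \val (\val g) = 1 - c^-1 *: \val (\val f) by [].
have /asboolP[k gk] := valP g.
have /unitr_1subnilp : g ^+ (2 ^ k) = 0.
  apply: val_inj; apply: val_inj; rewrite !rmorphXn; apply: blkdiag_nilp gk _ => i.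
  by rewrite gE !utmxE (bhat_diag (bhatP (\val f))) mulVf// subrr.
rewrite /g subKr => /unitrP[y [yf fy]].
apply/unitrP; exists (c^-1 *: y); split.
  by rewrite -scalerAl scalerAr.
by rewrite -scalerAr scalerAl.
Qed.

Lemma bloc_units_open : open (units (bloc R)).
Proof.
rewrite openE => f uf; apply/nbhs_bloc.
have f00 : \val (\val f) 0%N 0%N != 0.
  apply/eqP => f0; have /(congr1 (fun h => \val (\val h) 0%N 0%N)) := divrr uf.
  rewrite -[\val (\val (f / f))]/(\val (\val f) * \val (\val f^-1)) utmxM0E f0 mul0r.
  by move=> /eqP; rewrite eq_sym oner_eq0.
(* If [g] had zero diagonal, the corner entry of [f - g] would be that of [f], so [g] would lie
   outside this ball. *)
exists 0%N, (normc (\val (\val f) 0%N 0%N)).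
  by rewrite lt0r normc_ge0 andbT; apply: contra_neq f00 => /eq0_normc.
move=> g fg; apply: bloc_unit; apply: contraTneq fg => /= g0; rewrite -leNgt.
have := rowsum_entry 0 (\val (\val (f - g))) 0 0.
rewrite expr1n mulr1 [X in normc X](_ : _ = \val (\val f) 0%N 0%N); last first.
  by rewrite -[RHS]subr0 -g0.
move=> /le_trans; apply; apply: rowsum_wnorm.
by case: (bhatP (\val (f - g))).
Qed.

(** The exponents form the ruler sequence: the step from [i] to [i + 1] is small exactly where
    [i + 1] is divisible by a high power of 2, that is, at the boundaries of large blocks. *)
Definition ruler_shift (e : R) : utmx R[i] :=
  fun i l => if l == 1%N then (e * 2^-1 ^+ logn 2 i.+1)%:C%C else 0.

Lemma rowsum_shift n (f : utmx R[i]) i m a : (forall l, l != 1%N -> f i l = 0) ->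
  normc (f i 1%N) <= a -> rowsum n f i m <= a * n.+1%:R.
Proof.
move=> f0 fa; have a0 : 0 <= a by rewrite (le_trans (normc_ge0 _) fa).
case: m => [|[|m]]; rewrite /rowsum.
- by rewrite big_ord0 mulr_ge0.
- by rewrite big_ord1 f0// normc0 mul0r mulr_ge0.
rewrite 2!big_ord_recl big1 => [|l _]; last by rewrite f0// normc0 mul0r.
by rewrite f0// normc0 mul0r add0r addr0 expr1 ler_wpM2r.
Qed.

Lemma normc_ruler_shift e i : 0 < e ->
  normc (ruler_shift e i 1%N) = e * 2^-1 ^+ logn 2 i.+1.
Proof. by move=> e0; rewrite /ruler_shift eqxx normcR ger0_norm// mulr_ge0 ?exprn_ge0// ltW. Qed.

Lemma rowsum_ruler_shift n e i m : 0 < e ->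
  rowsum n (ruler_shift e) i m <= e * n.+1%:R.
Proof.
move=> e0; apply: rowsum_shift => [l /negbTE l1|]; first by rewrite /ruler_shift l1.
rewrite normc_ruler_shift// ler_piMr//; first exact: ltW.
by rewrite exprn_ile1 ?invr_ge0 ?invf_le1 ?ler1n.
Qed.

Lemma in_bhat_ruler_shift e : 0 < e -> in_bhat (ruler_shift e).
Proof.
move=> e0; split=> // [n|n d d0].
  by exists (e * n.+1%:R) => i m; exact: rowsum_ruler_shift.
have [k hk] : exists k, (2^-1 : R) ^+ k < d / n.+1%:R / e.
  have : 0 < d / n.+1%:R / e by rewrite !divr_gt0.
  move=> c0; have /cvgr_lt/(_ _ c0) : (GRing.exp (2^-1 : R)) @ \oo --> (0 : R).
    by apply: cvg_expr; rewrite ger0_norm ?invf_lt1 ?ltr1n// invr_ge0.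
  by move=> [k _ /(_ k (leqnn k))]; exists k.
exists k => i m; rewrite -[leRHS](@divfK _ n.+1%:R)//.
apply: rowsum_shift => [l /negbTE l1|].
  by rewrite !utmxE /blkdiag /ruler_shift l1; case: ifP; rewrite subrr.
rewrite !utmxE /blkdiag; case: ifPn => [_|].
  by rewrite subrr normc0 divr_ge0// ltW.
(* The entry crosses a block boundary, so [2 ^ k] divides [i.+1] and its valuation is at least
   [k]. *)
rewrite addn1 divnS ?expn_gt0// subr0 => h.
have ki : (k <= logn 2 i.+1)%N.
  by rewrite -pfactor_dvdn//; apply: contraNT h => /negbTE ->.
rewrite normc_ruler_shift// mulrC -ler_pdivlMr//.
apply: le_trans (ltW hk).
by rewrite ler_wiXn2l ?invr_ge0 ?invf_le1 ?ler1n.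
Qed.

(** Only offsets 0 and 1 of [1 - ruler_shift e] are nonzero, so row 0 of the equation says that
    [y 0 l.+1] is [y 0 l] times the shift entry of row [l]. The valuations of [1, ..., l] add up to
    that of the factorial. *)
Lemma normc_ruler_inverse e (y : utmx R[i]) l : 0 < e ->
  y * (1 - ruler_shift e) = 1 -> normc (y 0%N l) = e ^+ l * 2^-1 ^+ logn 2 l`!.
Proof.
move=> e0 yx; elim: l => [|l IH].
  have := congr1 (fun f : utmx R[i] => f 0%N 0%N) yx.
  rewrite utmxM0E !utmxE /ruler_shift subr0 mulr1 => ->.
  by rewrite normc1 !expr0 mulr1.
have := congr1 (fun f : utmx R[i] => f 0%N l.+1) yx.
rewrite utmxME 2!big_ord_recr /= big1 => [|[k /= kl] _]; last first.
  by rewrite !utmxE /ruler_shift; case: eqP => [|_]; [lia|case: eqP => [|_]; [lia|rewrite subrr mulr0]].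
rewrite subnn subSn// subnn !utmxE /= add0r !add0n sub0r mulrN.
rewrite [X in _ * (1 - X)](_ : _ = 0) ?subr0 ?mulr1 // addrC => /eqP.
rewrite subr_eq0 => /eqP ->; rewrite normcM IH normc_ruler_shift//.
by rewrite factS lognM ?fact_gt0// exprD !exprS; ring.
Qed.

Lemma ruler_not_unit e (f : bhat R) : 0 < e -> \val f = ruler_shift e ->
  1 - f \isn't a GRing.unit.
Proof.
move=> e0 fE; apply/negP => /unitrP[y [yf _]].
have yx : \val y * (1 - ruler_shift e) = 1 by rewrite -fE -[LHS]/(\val (y * (1 - f))) yf.
(* The weight of index [N] outgrows the decay [(e / 2) ^+ l] of the entries of the inverse: row sums
   then exceed every [2 ^+ l]. *)
have [N hN] : exists N : nat, 2 <= e / 2 * N.+1%:R.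
  exists (Num.bound (2 / (e / 2))); rewrite mulrC -ler_pdivrMr ?divr_gt0//.
  rewrite ltW// (lt_le_trans (archi_boundP _)) ?ler_nat//.
  by rewrite !divr_ge0 // ltW.
have [M yM] := bhat_bounded (bhatP y) N.
have le2 l : 2 ^+ l <= M.
  apply: le_trans (yM 0%N l.+1); apply: le_trans (rowsum_entry _ _ _ _).
  rewrite (normc_ruler_inverse _ e0 yx).
  rewrite (@le_trans _ _ ((e / 2 * N.+1%:R) ^+ l))//.
    by rewrite lerXn2r ?nnegrE// (le_trans _ hN).
  rewrite 2!exprMn ler_wpM2r ?exprn_ge0// ler_wpM2l ?exprn_ge0//; first exact: ltW.
  by rewrite ler_wiXn2l ?invr_ge0 ?invf_le1 ?ler1n ?logn2_fact.
have M0 : 0 <= M by rewrite (le_trans _ (le2 0%N)).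
have := le2 (Num.bound M); rewrite leNgt => /negP; apply.
rewrite (lt_le_trans (archi_boundP M0))// -natrX ler_nat.
by rewrite ltnW// ltn_expl.
Qed.

Lemma bhat_units_not_open : ~ open (units (bhat R)).
Proof.
rewrite openE => /(_ 1 (unitr1 _))/nbhs_bhat[n [e e0 eU]].
(* The shift with this parameter has [n]-th seminorm at most [e / 2], so 1 minus it lies in the
   given ball around 1. *)
have d0 : 0 < e / 2 / n.+1%:R by rewrite !divr_gt0.
have /bhat_predP hx := in_bhat_ruler_shift d0.
have /negP := @ruler_not_unit _ (Bhat hx) d0 erefl; apply; apply: eU => /=.
rewrite subKr (@le_lt_trans _ _ (e / 2)) ?ltr_pdivrMr ?ltr_pMr ?ltr1n//.
apply: wnorm_le => i m; rewrite (le_trans (rowsum_ruler_shift _ _ _ d0))//.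
by rewrite divfK.
Qed.

End Units.

(** * The completion and the main result *)

Lemma bloc_completion (R : realType) :
  is_hausdorff_completion (@bloc_incl R : {lrmorphism bloc R -> bhat R}).
Proof.
split.
- exact: bhat_complete.
- exact: sn_hausdorff (wnorm_system R) (@nbhs_bhat R) (@wnorm_sep R).
- move=> x U; split.
    move=> /nbhs_bloc[n [e e0 eU]].
    exists [set y | wnorm n (\val (bloc_incl x - y)) < e].
      by apply/nbhs_bhat; exists n, e.
    by move=> y xy; apply: eU.
  move=> [V /nbhs_bhat[n [e e0 eV]] VU]; apply/nbhs_bloc; exists n, e => //.
  by move=> y xy; apply: VU; apply: eV.
- move=> O [x Ox] Oo.
  have /nbhs_bhat[n [e e0 eO]] : nbhs x O by exact: open_nbhs_nbhs.
  have e20 : 0 < e / 2 by rewrite divr_gt0.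
  (* Density: the truncation of [x] to blocks of size [2 ^ k] lies in the subalgebra and within
     [e / 2] of [x]. *)
  have [k xk] := bhat_approx (bhatP x) n e20.
  have /bhat_predP hy := in_bhat_blkdiag k (bhatP x).
  have hb : Bhat hy \in @bloc_pred R by apply/asboolP; exists k; rewrite blkdiagK.
  exists (Bhat hy); split; last by exists (Bloc hb).
  apply: eO; apply: (@le_lt_trans _ _ (e / 2)).
    by apply: wnorm_le => i m; rewrite bhat_valB.
  by rewrite ltr_pdivrMr ?ltr_pMr ?ltr1n.
Qed.

Theorem theorem1p1 (R : realType) :
  exists B : locConvAlgType R[i],
    [/\ hausdorff_space B, metrizable R B, locally_m_convex B
      & continuous_inverse_algebra B] /\
    exists (Bhat : locConvAlgType R[i]) (i : {lrmorphism B -> Bhat}),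
      is_hausdorff_completion i /\
      [/\ frechet Bhat /\ locally_m_convex Bhat,
          inversion_continuous Bhat,
          ~ open (units Bhat)
        & ~ continuous_inverse_algebra Bhat].
Proof.
exists (bloc R); split.
  split.
  - exact: sn_hausdorff (bloc_system R) (@nbhs_bloc R) (@bloc_sep R).
  - exact: sn_metrizable (bloc_system R) (@nbhs_bloc R) (@bloc_sep R).
  - exact: sn_locally_m_convex (bloc_system R) (@nbhs_bloc R).
  - split; first exact: bloc_units_open.
    exact: sn_inversion_continuous (bloc_system R) (@nbhs_bloc R).
exists (bhat R), (@bloc_incl R); split; first exact: bloc_completion.
split.
- split; last exact: sn_locally_m_convex (wnorm_system R) (@nbhs_bhat R).
  split; first exact: bhat_complete.
    exact: sn_hausdorff (wnorm_system R) (@nbhs_bhat R) (@wnorm_sep R).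
  exact: sn_metrizable (wnorm_system R) (@nbhs_bhat R) (@wnorm_sep R).
- exact: sn_inversion_continuous (wnorm_system R) (@nbhs_bhat R).
- exact: bhat_units_not_open.
- by move=> [+ _]; exact: bhat_units_not_open.
Qed.
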